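(* Let $(G,\tau,\oplus)$ be a Hausdorff strongly topological gyrogroup. If the topological space $(G,\tau)$ is separable and metrizable, then $G$ has a suitable set.
   Context: A gyrogroup is a nonempty set $G$ with a binary operation $\oplus$ such that: (G1) there is a unique $0\in G$ with $0\oplus a=a=a\oplus 0$ for all $a\in G$; (G2) each $x\in G$ has a unique inverse $\ominus x\in G$ with $\ominus x\oplus x=0=x\oplus(\ominus x)$; (G3) there is a map $\mathrm{gyr}:G\times G\to \mathrm{Aut}(G,\oplus)$ (where $\mathrm{Aut}(G,\oplus)$ is the set of bijections $G\to G$ preserving $\oplus$) with $x\oplus(y\oplus z)=(x\oplus y)\oplus \mathrm{gyr}[x,y](z)$ for all $x,y,z\in G$; (G4) $\mathrm{gyr}[x\oplus y,y]=\mathrm{gyr}[x,y]$ for all $x,y\in G$. A topological gyrogroup $(G,\tau,\oplus)$ is a gyrogroup with a topology such that $\oplus:G\times G\to G$ is jointly continuous and $\ominus:G\to G$ is continuous. It is a strongly topological gyrogroup if there is a neighborhood base $\mathscr U$ of $0$ with $\mathrm{gyr}[x,y](U)=U$ for all $x,y\in G$ and $U\in\mathscr U$. A subgyrogroup of $G$ is a nonempty subset $H$ closed under $\oplus$ such that for all $x,y\in H$ the restriction $\mathrm{gyr}[x,y]|_H:H\to\mathrm{gyr}[x,y](H)$ is a bijective homomorphism and $(H,\oplus|_{H\times H})$ is a gyrogroup. For $S\subset G$, $\langle S\rangle$ denotes the smallest subgyrogroup of $G$ containing $S$. A subset $S$ of a topological gyrogroup $G$ is a suitable set for $G$ if $S$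 is discrete in its subspace topology, $\langle S\rangle$ is dense in $G$, and $S\cup\{0\}$ is closed in $G$. *)

(* Defs.v *)
From HB Require Import structures.
From mathcomp Require Import all_boot all_order all_algebra.
From mathcomp Require Import all_classical all_reals all_analysis.

Set Implicit Arguments.
Unset Strict Implicit.
Unset Printing Implicit Defensive.

Import Order.TTheory GRing.Theory Num.Theory.

Local Open Scope classical_set_scope.
Local Open Scope ring_scope.

Record gyrogroup_axioms (T : Type) (add : T -> T -> T) (zero : T)
    (opp : T -> T) (gyr : T -> T -> T -> T) : Prop := GyrogroupAxioms {
  gyro_zeroP :
    unique (fun e => forall a, add e a = a /\ add a e = a) zero;
  gyro_oppP : forall x,
    unique (fun y => add y x = zero /\ add x y = zero) (opp x);
  gyr_bij : forall x y, bijective (gyr x y);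
  gyr_morph : forall x y, {morph gyr x y : a b / add a b};
  gyro_addA : forall x y z, add x (add y z) = add (add x y) (gyr x y z);
  gyr_loop : forall x y, gyr (add x y) y = gyr x y
}.

(* The identity, inverse and gyrations of a gyrogroup are determined by its
   operation, so being a gyrogroup is a property of the operation alone. *)
Definition is_gyrogroup (T : Type) (add : T -> T -> T) : Prop :=
  exists zero opp gyr, gyrogroup_axioms add zero opp gyr.

HB.mixin Record isGyrogroup (G : Type) := {
  gyroadd : G -> G -> G;
  gyrozero : G;
  gyroopp : G -> G;
  gyr : G -> G -> G -> G;
  gyrogroupP : gyrogroup_axioms gyroadd gyrozero gyroopp gyr
}.

#[short(type="gyrogroupType")]
HB.structure Definition Gyrogroup := { G of isGyrogroup G }.

Arguments gyrozero {s}.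

Declare Scope gyro_scope.
Delimit Scope gyro_scope with gyro.
Notation "x ⊕ y" := (gyroadd x y)
  (at level 50, left associativity) : gyro_scope.
Notation "⊖ x" := (gyroopp x) (at level 35, right associativity) : gyro_scope.
Local Open Scope gyro_scope.

HB.mixin Record isTopologicalGyrogroup G & Topological G & isGyrogroup G := {
  gyroadd_continuous : continuous (fun p : G * G => p.1 ⊕ p.2);
  gyroopp_continuous : continuous (fun x : G => ⊖ x)
}.

#[short(type="topologicalGyrogroupType")]
HB.structure Definition TopologicalGyrogroup :=
  { G of Topological G & isGyrogroup G & isTopologicalGyrogroup G }.

Definition strongly_topological (G : topologicalGyrogroupType) : Prop :=
  exists2 U : set (set G), nbhs (gyrozero : G) = filter_from U id &
    forall (x y : G) (V : set G), U V -> gyr x y @` V = V.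

Definition restricted_gyroadd (G : gyrogroupType) (H : set G)
    (Hadd : forall x y, H x -> H y -> H (x ⊕ y)) (x y : H) : H :=
  exist _ (set_val x ⊕ set_val y)
    (mem_set (Hadd _ _ (set_valP x) (set_valP y))).

Definition subgyrogroup (G : gyrogroupType) (H : set G) : Prop :=
  [/\ H !=set0,
      forall x y, H x -> H y ->
        set_bij H (gyr x y @` H) (gyr x y) /\
        (forall a b, H a -> H b ->
           gyr x y (a ⊕ b) = gyr x y a ⊕ gyr x y b) &
      exists Hadd : forall x y, H x -> H y -> H (x ⊕ y),
        is_gyrogroup (restricted_gyroadd Hadd)].

Definition generated (G : gyrogroupType) (S : set G) : set G :=
  smallest (@subgyrogroup G) S.

(* [S] is used as a type, which carries the subspace topology. *)
Definition discrete_subset (T : topologicalType) (S : set T) : Prop :=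
  forall A : set S, open A.

Definition suitable (G : topologicalGyrogroupType) (S : set G) : Prop :=
  [/\ discrete_subset S, dense (generated S) & closed (S `|` [set gyrozero])].

Definition separable (T : topologicalType) : Prop :=
  exists2 D : set T, countable D & dense D.

Record is_metric (R : realType) (T : Type) (d : T -> T -> R) : Prop := IsMetric {
  metric_refl : forall x, d x x = 0;
  metric_separated : forall x y, d x y = 0 -> x = y;
  metric_symmetric : forall x y, d x y = d y x;
  metric_triangular : forall y x z, d x z <= d x y + d y z
}.

Definition metrizable (R : realType) (T : topologicalType) : Prop :=
  exists2 d : T -> T -> R, is_metric d &
    forall A : set T,
      open A <-> forall x, A x -> exists2 e : R, 0 < e & [set y | d x y < e] `<=` A.

(* Main.v *)
Require Import Defs.
From mathcomp Require Import all_boot all_order all_algebra.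
From mathcomp Require Import all_classical all_reals all_analysis.

(** Let [U 0 = G] and let [U k], [k > 0], be the ball of radius [1/k] around
    [0].  Choose in every [U k] a maximal [U k.+1]-separated set [X k]; then
    [X k] is locally finite and every element of [U k] has the form [x ⊕ u]
    with [x] in [X k] and [u] in [U k.+1].  Hence any [d] can be written
    [x_0 ⊕ (x_1 ⊕ (... ⊕ (x_(n-1) ⊕ u)))] with [x_k] in [X k] and [u] in
    [U n].  Doing this for the [n]-th point of a countable dense set, and
    calling [f n] the last summand, the set of all the nonzero points of the
    [X k] and all the nonzero [f n] generates a dense subgyrogroup.  As both
    [X n] and [f n] lie in [U n], it accumulates at most at [0]. *)

Import Order.TTheory GRing.Theory Num.Theory.

Local Open Scope classical_set_scope.
Local Open Scope ring_scope.
Local Open Scope gyro_scope.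

Section GyrogroupTheory.
Variable G : gyrogroupType.
Implicit Types (x y z : G) (H S : set G).

Lemma gyroadd0 x : gyrozero ⊕ x = x.
Proof. by have [+ _] := gyro_zeroP (gyrogroupP (s := G)) => /(_ x)[]. Qed.

Lemma gyroaddN x : ⊖ x ⊕ x = gyrozero.
Proof. by have [[]] := gyro_oppP (gyrogroupP (s := G)) x. Qed.

Lemma gyroaddxN x : x ⊕ ⊖ x = gyrozero.
Proof. by have [[]] := gyro_oppP (gyrogroupP (s := G)) x. Qed.

(** Translating by [x] and then by [⊖ x] is the gyration [gyr (⊖ x) x], a bijection. *)
Lemma gyroaddI x : injective (gyroadd x).
Proof.
move=> y z xyz; have axioms := gyrogroupP (s := G).
apply: (bij_inj (gyr_bij axioms (⊖ x) x)).
have gyrE t : gyr (⊖ x) x t = ⊖ x ⊕ (x ⊕ t).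
  by rewrite (gyro_addA axioms) gyroaddN gyroadd0.
by rewrite !gyrE xyz.
Qed.

(* The loop property gives [gyr (⊖ x) x = gyr 0 x], which is the identity. *)
Lemma gyroaddKl x z : ⊖ x ⊕ (x ⊕ z) = z.
Proof.
have axioms := gyrogroupP (s := G).
rewrite (gyro_addA axioms) -(gyr_loop axioms) gyroaddN gyroadd0.
apply: (gyroaddI x).
by rewrite -[in RHS](gyroadd0 (x ⊕ z)) (gyro_addA axioms) gyroadd0.
Qed.

Lemma gyroaddNKl x z : x ⊕ (⊖ x ⊕ z) = z.
Proof. by apply: (gyroaddI (⊖ x)); rewrite gyroaddKl. Qed.

Lemma subgyrogroup_add H x y : subgyrogroup H -> H x -> H y -> H (x ⊕ y).
Proof. by case=> _ _ [Hadd _]; exact: Hadd. Qed.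

(** The identity [e] of [H] satisfies [e ⊕ e = e = e ⊕ gyrozero] in [G]; cancel [e] on the left. *)
Lemma subgyrogroup0 H : subgyrogroup H -> H gyrozero.
Proof.
case=> _ _ [Hadd [e [opp [gy axioms]]]].
have [/(_ e)[ee _] _] := gyro_zeroP axioms.
have {}ee := congr1 set_val ee.
suff <- : set_val e = gyrozero by exact: set_valP.
apply: (gyroaddI (set_val e)); rewrite [LHS]ee.
by have [/(_ (set_val e))[]] := gyro_zeroP (gyrogroupP (s := G)).
Qed.

Lemma sub_generated S : S `<=` generated S.
Proof. exact: sub_smallest. Qed.

Lemma generated_add S x y :
  generated S x -> generated S y -> generated S (x ⊕ y).
Proof.
move=> Sx Sy H [sgH SH].
by apply: subgyrogroup_add => //; [exact: Sx | exact: Sy].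
Qed.

Lemma generated0 S : generated S gyrozero.
Proof. by move=> H [sgH _]; exact: subgyrogroup0. Qed.

End GyrogroupTheory.

Section Separated.
Variable G : gyrogroupType.
Implicit Types (U V X : set G).

(** [V] need not be symmetric. Asking for both differences lets a failure of either one separate two
    points, whatever their order. *)
Definition gyro_separated V X :=
  forall x y : G, X x -> X y -> V (⊖ x ⊕ y) -> V (⊖ y ⊕ x) -> x = y.

Lemma maximal_separated U V : V gyrozero -> exists X : set G,
  [/\ X `<=` U, gyro_separated V X &
      forall u, U u -> exists2 x, X x & V (⊖ x ⊕ u)].
Proof.
move=> V0.
pose P X := X `<=` U /\ gyro_separated V X.
have [X [[XU sepX] maxX]] : exists X, P X /\ forall B, X `<` B -> ~ P B.
  apply: Zorn_bigcup => F FP totF; split.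
    by move=> x [A FA Ax]; exact: (FP _ FA).1.
  move=> x y [A FA Ax] [B FB By].
  have [AB|BA] := totF _ _ FA FB.
    by apply: (FP _ FB).2 => //; exact: AB.
  by apply: (FP _ FA).2 => //; exact: BA.
exists X; split=> // u Uu; apply: contrapT => noX.
have far x : X x -> ~ V (⊖ x ⊕ u) by move=> Xx Vxu; apply: noX; exists x.
apply: (maxX (X `|` [set u])).
  split; first by move=> x; left.
  (* The extension is proper: a [u] in [X] would be covered by itself. *)
  move=> /(_ u (or_intror erefl)) Xu; apply: (far u Xu).
  by rewrite gyroaddN.
split=> [x [/XU//|->//]|x y [Xx|->] [Xy|->]] //.
- exact: sepX.
- by move=> /(far _ Xx).
- by move=> _ /(far _ Xy).
Qed.

End Separated.

Lemma hausdorff_near_neq (T : topologicalType) (y z : T) :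
  hausdorff_space T -> z <> y -> \forall s \near y, s <> z.
Proof.
move=> hausT zy.
have := @accessible_closed_set1 _ (hausdorff_accessible hausT) z.
rewrite -openC openE => /(_ y); apply=> /=.
by move=> yz; exact: zy.
Qed.

Section TopologicalGyrogroupTheory.
Variable G : topologicalGyrogroupType.
Implicit Types (U V X S : set G) (y : G).

(** The map [(a, b) |-> ⊖ a ⊕ b] is continuous and sends [(y, y)] to the identity. *)
Lemma near_gyrosub V y : nbhs (gyrozero : G) V ->
  exists2 W, nbhs y W & forall a b, W a -> W b -> V (⊖ a ⊕ b).
Proof.
move=> V0.
have : (fun p : G * G => ⊖ p.1 ⊕ p.2) @ (y, y) --> ⊖ y ⊕ y.
  have cN : (fun p : G * G => ⊖ p.1) @ (y, y) --> ⊖ y.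
    by apply: continuous_cvg; [exact: gyroopp_continuous | exact: cvg_fst].
  have := @gyroadd_continuous G (⊖ y, y).
  apply: cvg_trans.
  exact: (cvg_app (fun p : G * G => p.1 ⊕ p.2) (cvg_pair cN cvg_snd)).
rewrite gyroaddN => /(_ _ V0) [[A B] /= [yA yB] AB].
exists (A `&` B); first exact: filterI.
by move=> a b [Aa _] [_ Bb]; exact: (AB (a, b)).
Qed.

(** A neighborhood of [y] with all differences in [V] contains at most one point of [X]; if that
    point is not [y], the Hausdorff property removes it. *)
Lemma separated_near V X y : hausdorff_space G ->
  nbhs (gyrozero : G) V -> gyro_separated G V X ->
  \forall s \near y, X s -> s = y.
Proof.
move=> hausG V0 sepX; have [W yW WV] := near_gyrosub V y V0.
have [[x [Xx Wx xy]]|none] := pselect (exists x, [/\ X x, W x & x <> y]).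
  have neqx := hausdorff_near_neq _ y x hausG xy.
  apply: filterS (filterI yW neqx) => s [Ws sx] Xs.
  by case: sx; apply: sepX => //; exact: WV.
apply: filterS yW => s Ws Xs; apply: contrapT => sy.
by apply: none; exists s.
Qed.

Lemma discrete_closed_off0 S : hausdorff_space G -> ~ S gyrozero ->
  (forall y, y <> gyrozero -> \forall s \near y, S s -> s = y) ->
  discrete_subset S /\ closed (S `|` [set gyrozero]).
Proof.
move=> hausG S0 nearS; split.
  move=> A; rewrite openE => a Aa.
  have a0 : set_val a <> gyrozero.
    by move=> a0; apply: S0; rewrite -a0; exact: set_valP.
  have : nbhs (set_val a) [set s | S s -> s = set_val a] by exact: nearS.
  rewrite nbhsE => -[B [oB Ba] Bs].
  rewrite /interior nbhsE; exists (set_val @^-1` B).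
    by split=> //; exists B.
  move=> b /= Bb; suff -> : b = a by [].
  apply: val_inj; apply: Bs => //; exact: set_valP.
rewrite -openC openE => y /= /not_orP[Sy y0].
have neq0 := hausdorff_near_neq _ y gyrozero hausG (nesym y0).
apply: filterS (filterI (nearS _ y0) neq0) => s [Ssy s0] [Ss|//].
by apply: Sy; rewrite -(Ssy Ss).
Qed.

End TopologicalGyrogroupTheory.

Lemma metric_ball_nbhs (R : realType) (T : topologicalType) (d : T -> T -> R)
    (x : T) (e : R) :
  is_metric d ->
  (forall A : set T, open A <->
    forall x, A x -> exists2 e : R, 0 < e & [set y | d x y < e] `<=` A) ->
  0 < e -> nbhs x [set y | d x y < e].
Proof.
move=> md openP e0; apply: open_nbhs_nbhs; split; last first.
  by rewrite /= (metric_refl md).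
apply/openP => y /= xy; exists (e - d x y); first by rewrite subr_gt0.
move=> z /=; rewrite ltrBrDl; apply: le_lt_trans.
exact: (metric_triangular md).
Qed.

Lemma metric_ge0 (R : realType) (T : Type) (d : T -> T -> R) (x y : T) :
  is_metric d -> 0 <= d x y.
Proof.
move=> md; have := metric_triangular md y x x.
by rewrite (metric_refl md) (metric_symmetric md y) -mulr2n pmulrn_lge0.
Qed.

Lemma countable_sub_range (T : Type) (x0 : T) (D : set T) :
  countable D -> exists f : nat -> T, D `<=` range f.
Proof.
(* The default [x0] serves only for an empty [D]. *)
move=> /pfcard_geP[->|[f]]; first by exists (fun=> x0).
by exists f => x /(@surj _ _ _ _ f) [n _ <-]; exists n.
Qed.

Theorem corollary4p15 (R : realType) (G : topologicalGyrogroupType)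
    (hausG : hausdorff_space G) (strongG : strongly_topological G)
    (sepG : separable G) (metrG : metrizable R G) :
  exists S : set G, suitable S.
Proof.
case: metrG => d md openP; case: sepG => D cD denseD.
have [D_ DD_] := countable_sub_range G gyrozero D cD.
(* Multiplying by [n] rather than comparing with its inverse makes [U 0] the whole of [G]. *)
pose U n := [set y : G | d gyrozero y * n%:R < 1].
have nbhsU n : nbhs (gyrozero : G) (U n).
  case: n => [|n]; first by apply: filterS filterT => y _; rewrite /U /= mulr0.
  have := metric_ball_nbhs _ _ d gyrozero n.+1%:R^-1 md openP.
  rewrite invr_gt0 ltr0Sn => /(_ isT); apply: filterS => y /=.
  by rewrite /U /= -ltr_pdivlMr ?ltr0Sn// div1r.
have awayU y : y <> gyrozero ->
    exists n, \forall s \near y, forall m, (n <= m)%N -> ~ U m s.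
  move=> y0; set r := d gyrozero y.
  have r0 : 0 < r.
    rewrite lt_neqAle metric_ge0// andbT; apply/eqP => r0.
    by apply: y0; rewrite -(metric_separated md (esym r0)).
  (* Points within [r / 2] of [y] are at distance at least [r / 2] from the identity, hence outside
     [U m] as soon as [m] is at least [2 / r]. *)
  pose n := Num.bound (r / 2)^-1; exists n.
  have r20 : 0 < r / 2 by rewrite divr_gt0.
  have := metric_ball_nbhs _ _ d y (r / 2) md openP r20.
  apply: filterS => s /= ys m nm; rewrite /U /=; apply/negP; rewrite -leNgt.
  have rs : r / 2 <= d gyrozero s.
    have := metric_triangular md s gyrozero y.
    rewrite (metric_symmetric md s) -/r -lerBlDr; apply: le_trans.
    by rewrite [X in _ <= X - _]splitr -addrA lerDl subr_ge0 ltW.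
  have rn : 1 <= r / 2 * n%:R.
    rewrite -ler_pdivrMl// mulr1; apply: ltW.
    by apply: archi_boundP; rewrite invr_ge0 ltW.
  apply: (le_trans rn); apply: ler_pM; rewrite ?ler0n ?ler_nat//.
  exact: ltW.
have [X XP] := choice (fun k =>
  maximal_separated G (U k) (U k.+1) (nbhs_singleton (nbhsU k.+1))).
(* Quantifying over the sets [K] closed under [⊕] replaces writing out the nested sum: [g] is built
   from points of the [X k] and the remainder [u]. *)
have chain n (g : G) : exists u, U n u /\
    forall K : set G, (forall x y, K x -> K y -> K (x ⊕ y)) ->
      (forall k, X k `<=` K) -> K u -> K g.
  elim: n => [|m [u [Um uK]]].
    by exists g; rewrite /U /= mulr0.
  have [_ _ /(_ u Um)[x Xx Ux]] := XP m.
  exists (⊖ x ⊕ u); split=> // K Kadd KX Ku; apply: uK => //.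
  by rewrite -(gyroaddNKl _ x u); apply: Kadd => //; exact: (KX m).
have [f fP] := choice (fun n => chain n (D_ n)).
pose S := (\bigcup_k X k `|` range f) `\ (gyrozero : G).
have nearS y : y <> gyrozero -> \forall s \near y, S s -> s = y.
  move=> y0; have [n yn] := awayU y y0.
  (* Only the indices below [n] matter near [y], so finitely many neighborhoods are intersected. *)
  have nearn : \forall s \near y, forall k, (k < n)%N ->
      (X k s -> s = y) /\ (s = f k -> s = y).
    elim: n {yn} => [|n IHn]; first by apply: filterS filterT.
    have [_ sepX _] := XP n.
    have nX := separated_near _ _ _ y hausG (nbhsU n.+1) sepX.
    have nf : \forall s \near y, s = f n -> s = y.
      have [<-|fy] := pselect (f n = y); first by apply: filterS filterT.
      apply: filterS (hausdorff_near_neq _ y _ hausG fy) => s sf /sf[].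
    apply: filterS (filterI IHn (filterI nX nf)) => s [IH [sX sf]] k.
    by rewrite ltnS leq_eqVlt => /predU1P[->//|/IH].
  apply: filterS (filterI yn nearn) => s [sn sk] [[[k _ Xks]|[k _ fks]] _].
    have [/(sn _) nU|/sk[/(_ Xks)//]] := leqP n k.
    by have [/(_ _ Xks)] := XP k.
  have [/(sn _) nU|/sk[_]] := leqP n k; last by apply.
  by case: nU; rewrite -fks; exact: (fP k).1.
have S0 : ~ S gyrozero by case=> _; apply.
have [discS closedS] := discrete_closed_off0 _ _ hausG S0 nearS.
exists S; split=> //.
(* Removing the identity from [S] loses nothing, as every subgyrogroup contains it. *)
have genS x : (\bigcup_k X k `|` range f) x -> generated S x.
  move=> Sx; have [->|x0] := pselect (x = gyrozero); first exact: generated0.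
  by apply: sub_generated; split.
move=> O O0 oO; have [z [Oz /DD_[n _ zE]]] := denseD O O0 oO.
exists z; split=> //; rewrite -zE; apply: ((fP n).2 (generated S)).
- by move=> x y; exact: generated_add.
- by move=> k x Xx; apply: genS; left; exists k.
- by apply: genS; right; exists n.
Qed.
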